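(* Let $A$ be a nonzero commutative ring with unity. Then $A$ is a quasi second ring if and only if either $A$ is a local ring with unique maximal ideal $\mathfrak{m}$ satisfying $\mathfrak{m}^2=0$, or $A$ is (isomorphic to) a direct product of two fields.
   Context: A commutative ring $A$ with unity is a quasi second ring if $A$ is a quasi second module over itself, i.e. for all $a,b\in A$, $0\neq bA\subseteq aA\neq A$ implies $bA=aA$. ''Local'' means having exactly one maximal ideal (no Noetherian hypothesis). *)

(* Defs.v *)
From HB Require Import structures.
From mathcomp Require Import all_boot all_order all_algebra.
From mathcomp Require Import boolp classical_sets.

Set Implicit Arguments.
Unset Strict Implicit.
Unset Printing Implicit Defensive.

Import GRing.Theory.

Local Open Scope classical_set_scope.
Local Open Scope ring_scope.

Definition scaled_module (R : comNzRingType) (M : lmodType R) (a : R) : set M :=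
  range (fun x : M => a *: x).
Arguments scaled_module {R} M a _.

Definition quasi_second_module (R : comNzRingType) (M : lmodType R) : Prop :=
  forall a b : R,
    scaled_module M b <> [set 0] ->
    scaled_module M b `<=` scaled_module M a ->
    scaled_module M a <> setT ->
    scaled_module M b = scaled_module M a.

Definition quasi_second_ring (A : comNzRingType) : Prop :=
  quasi_second_module A^o.

(* [idealr_closed] includes properness ([1 \notin S]). It expects a boolean
   predicate; [x \in I] is classical membership, so [I] is an arbitrary set. *)
Definition is_proper_ideal (A : comNzRingType) (I : set A) : Prop :=
  idealr_closed [pred x | x \in I].

Definition maximal_ideal (A : comNzRingType) (I : set A) : Prop :=
  is_proper_ideal I /\
  forall J : set A, is_proper_ideal J -> I `<=` J -> J = I.

Definition local_with_maximal_ideal (A : comNzRingType) (m : set A) : Prop :=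
  unique (@maximal_ideal A) m.

Definition ideal_mul (A : comNzRingType) (I J : set A) : set A :=
  [set x | exists (n : nat) (u v : 'I_n -> A),
     [/\ forall i, I (u i), forall i, J (v i) & x = \sum_(i < n) u i * v i]].

Definition ring_isomorphic (A B : comNzRingType) : Prop :=
  exists f : {rmorphism A -> B}, bijective f.

(* Main.v *)
Require Import Defs.
From HB Require Import structures.
From mathcomp Require Import all_boot all_order all_algebra.
From mathcomp Require Import boolp classical_sets.
From mathcomp Require Import ring.

Set Implicit Arguments.
Unset Strict Implicit.
Unset Printing Implicit Defensive.

(** Elementwise, a ring is quasi second when every non-unit [a] can be recovered
    from each of its nonzero multiples [a * c], that is, [a] lies in the ideal
    generated by [a * c] ([quasi_second_ringP]).

    Suppose that this holds. If some non-unit [a] has [a ^+ 2 != 0], then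
    [a = a ^+ 2 * d], so [e = a * d] is an idempotent with [a * e = a], and it
    is neither 0 nor 1. Both [e] and [1 - e] are non-units, so they are
    multiples of each of their own nonzero multiples: the rings [eA] and
    [(1 - e)A] are fields, and [A] is their product by Peirce decomposition
    ([quasi_second_product]).
    Otherwise all non-units have square zero. They then form an ideal, which is
    the only maximal one, and its square vanishes: if [a * b != 0] with [a] and
    [b] non-units, then [a] is a multiple of [a * b], hence [a * b] is a multiple
    of [a * b ^+ 2 = 0] ([quasi_second_local]).

    Conversely, let [m] be a maximal ideal with [m ^ 2 = 0]. An element outside
    [m] divides [1 - x] for some [x] in [m], and [1 - x] has the inverse
    [1 + x]; so any element outside [m] is a unit. If [a] is not a unit and
    [a * c != 0], then [a] is in [m], so [c] is not in [m] and is a unit. For a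
    product of two fields, a non-unit has a zero coordinate, and the claim is a
    division in the other coordinate. *)

Import GRing.Theory.

Local Open Scope classical_set_scope.
Local Open Scope ring_scope.

(** * Principal ideals and units *)

(** [A] carries no inverse operation, so being a unit is a bare existential. *)
Definition invertible (A : comNzRingType) (a : A) : Prop := exists x, a * x = 1.

(** With [b = a * c], the inclusion [bA <= aA] is automatic, and the reverse one
    means that [a] is a multiple of [b]. *)
Lemma quasi_second_ringP (A : comNzRingType) :
  quasi_second_ring A <->
  forall a c : A, a * c <> 0 -> invertible a \/ exists d, a = a * c * d.
Proof.
have mulP (a x : A) : scaled_module A^o a x <-> exists y, x = a * y.
  by split=> [[y _ <-]|[y ->]]; exists y.
split=> [qA a c ac0|H a b b0 sba aT].
  have [ua|nua] := pselect (invertible a); [by left | right].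
  have aa : scaled_module A^o a a by apply/mulP; exists 1; rewrite mulr1.
  apply/mulP; rewrite -/(scaled_module _ _ _) (qA a (a * c)) //.
  - move=> E; apply: ac0.
    have : scaled_module A^o (a * c) (a * c).
      by apply/mulP; exists 1; rewrite mulr1.
    by rewrite E.
  - by move=> x /mulP[y ->]; apply/mulP; exists (c * y); rewrite mulrA.
  - move=> E; apply: nua.
    have /mulP[y ey] : scaled_module A^o a 1 by rewrite E.
    by exists y.
have /sba /mulP[c bE] : scaled_module A^o b b.
  by apply/mulP; exists 1; rewrite mulr1.
have ac0 : a * c <> 0.
  move=> ac0; apply: b0; apply/seteqP; split=> x /=.
    by move=> /mulP[y ->]; rewrite bE ac0 mul0r.
  by move=> ->; apply/mulP; exists 0; rewrite mulr0.
have [[x ax]|[d aE]] := H _ _ ac0.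
  case: aT; apply/seteqP; split=> // y _.
  by apply/mulP; exists (x * y); rewrite mulrA ax mul1r.
apply/seteqP; split=> // y /mulP[z ->].
by apply/mulP; exists (d * z); rewrite mulrA bE -aE.
Qed.

(** * The two families of examples *)

(** By maximality, [m] and an element [a] outside it generate the unit ideal, so
    some multiple of [a] differs from 1 by an element of square zero. *)
Lemma maximal_ideal_invertible (A : comNzRingType) (m : set A) :
  maximal_ideal m -> (forall x y, m x -> m y -> x * y = 0) ->
  forall a, ~ m a -> invertible a.
Proof.
move=> [[m0 m1 mcl] mmax] mm a nma.
have {}m0 : m 0 by move: m0; rewrite inE.
have {}mcl r x y : m x -> m y -> m (r * x + y).
  by move=> mx my; have := mcl r x y; rewrite !inE; apply.
pose J : set A := [set x | exists2 u, m u & exists y, x = u + a * y].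
have [[u mu [y E]]|nJ1] := pselect (J 1).
  (* [a * y = 1 - u] with [u ^+ 2 = 0], whose inverse is [1 + u] *)
  exists (y * (1 + u)).
  have aE : a * y = 1 - u by rewrite E; ring.
  by rewrite mulrA aE mulrDr mulr1 mulrBl mul1r (mm u u) // subr0 subrK.
case: nma; rewrite -(mmax J).
- by exists 0 => //; exists 1; rewrite mulr1 add0r.
- split; first by rewrite inE; exists 0 => //; exists 0; rewrite mulr0 addr0.
    by rewrite inE /=; apply/negP => /asboolP.
  move=> r x z; rewrite !inE => -[u mu [y ->]] [v mv [w ->]].
  exists (r * u + v); first exact: mcl.
  by exists (r * y + w); ring.
- by move=> x mx; exists x => //; exists 0; rewrite mulr0 addr0.
Qed.

(** A nonzero product cannot have both factors in [m], and a factor outside [m]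
    is a unit. *)
Lemma local_quasi_second (A : comNzRingType) (m : set A) :
  maximal_ideal m -> ideal_mul m m = [set 0] -> quasi_second_ring A.
Proof.
move=> mmax mm0.
have mm x y : m x -> m y -> x * y = 0.
  move=> mx my; have : ideal_mul m m (x * y).
    exists 1%N, (fun=> x), (fun=> y); split=> //.
    by rewrite big_ord_recl big_ord0 addr0.
  by rewrite mm0.
have inv := maximal_ideal_invertible mmax mm.
apply/quasi_second_ringP => a c ac0.
have [ma|/inv] := pselect (m a); last by left.
have [mc|/inv[x cx]] := pselect (m c); first by case: ac0; apply: mm.
by right; exists x; rewrite -mulrA cx mulr1.
Qed.

(** If both coordinates of [u] are nonzero, [u] is a unit. Otherwise the zero
    coordinate is recovered trivially, and the other one by dividing by the
    corresponding coordinate of [w], which is nonzero because [u * w] is. *)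
Lemma field_product_recover (K L : fieldType) (u w : K * L) :
  u * w <> 0 -> (exists v, u * v = 1) \/ exists v, u = u * w * v.
Proof.
case: u w => [u1 u2] [w1 w2] uw0.
have [u1z|u1n] := eqVneq u1 0.
  right; exists (0, w2^-1); congr pair => /=; first by rewrite mulr0.
  have w2n : w2 != 0.
    by apply/eqP => w2z; apply: uw0; rewrite u1z w2z; congr pair;
       rewrite /= ?mul0r ?mulr0.
  by rewrite mulfK.
have [u2z|u2n] := eqVneq u2 0.
  right; exists (w1^-1, 0); congr pair => /=; last by rewrite mulr0.
  have w1n : w1 != 0.
    by apply/eqP => w1z; apply: uw0; rewrite u2z w1z; congr pair;
       rewrite /= ?mul0r ?mulr0.
  by rewrite mulfK.
by left; exists (u1^-1, u2^-1); congr pair; rewrite /= divff.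
Qed.

Lemma field_product_quasi_second (A : comNzRingType) (K L : fieldType) :
  ring_isomorphic A (K * L)%type -> quasi_second_ring A.
Proof.
move=> [f [g fK gK]]; apply/quasi_second_ringP => a c ac0.
have fac0 : f a * f c <> 0.
  by rewrite -rmorphM => E; apply: ac0; apply: (can_inj fK); rewrite E rmorph0.
have [[v E]|[v E]] := field_product_recover fac0.
  by left; exists (g v); apply: (can_inj fK); rewrite rmorphM gK rmorph1.
by right; exists (g v); apply: (can_inj fK); rewrite !rmorphM gK.
Qed.

(** * The field cut out by an idempotent *)

Section Corner.
Variables (A : comNzRingType) (e : A).

(** The conditions for [eA], with [e] as its identity, to be a field. *)
Definition field_idempotent : Prop :=
  [/\ e * e = e, e != 0 & forall x, x * e = x -> x != 0 -> exists y, x * y = e].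

Definition corner_pred : {pred A} := [pred x | x * e == x].

Lemma corner_zmod_closed : zmod_closed corner_pred.
Proof.
split=> [|x y]; rewrite !inE; first by rewrite mul0r.
by move=> /eqP xe /eqP ye; rewrite mulrBl xe ye.
Qed.

HB.instance Definition _ := GRing.isZmodClosed.Build A corner_pred
  corner_zmod_closed.

(** The proof argument lets the type determine the field structure. *)
Definition corner (eP : field_idempotent) := {x : A | x \in corner_pred}.

Variable eP : field_idempotent.
Local Notation eA := (corner eP).

HB.instance Definition _ := SubChoice.on eA.
HB.instance Definition _ := [SubChoice_isSubZmodule of eA by <:].

Lemma corner_val_idem (x : eA) : val x * e = val x.
Proof. by apply/eqP; have := valP x; rewrite inE. Qed.

Lemma corner_mulP (x : A) : x * e \in corner_pred.
Proof. by have [ee _ _] := eP; rewrite inE -mulrA ee. Qed.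

(** The ring morphism from [A] onto [eA]; it provides the identity and the
    product of [eA]. *)
Definition corner_proj (x : A) : eA := Sub (x * e) (corner_mulP x).

Lemma val_corner_proj x : val (corner_proj x) = x * e.
Proof. exact: SubK. Qed.

Definition corner_one : eA := corner_proj 1.
Definition corner_mul (x y : eA) : eA := corner_proj (val x * val y).

Lemma val_corner_mul x y : val (corner_mul x y) = val x * val y.
Proof. by rewrite val_corner_proj -mulrA corner_val_idem. Qed.

Lemma val_corner_one : val corner_one = e.
Proof. by rewrite val_corner_proj mul1r. Qed.

Lemma corner_mulA : associative corner_mul.
Proof. by move=> x y z; apply: val_inj; rewrite !val_corner_mul mulrA. Qed.

Lemma corner_mulC : commutative corner_mul.
Proof. by move=> x y; apply: val_inj; rewrite !val_corner_mul mulrC. Qed.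

Lemma corner_mul1 : left_id corner_one corner_mul.
Proof.
move=> x; apply: val_inj.
by rewrite val_corner_mul val_corner_one mulrC corner_val_idem.
Qed.

Lemma corner_mulDl : left_distributive corner_mul +%R.
Proof.
have valD (u v : eA) : val (u + v) = val u + val v by exact: raddfD.
move=> x y z; apply: val_inj.
by rewrite valD !val_corner_mul valD mulrDl.
Qed.

Lemma corner_one_neq0 : corner_one != 0.
Proof.
have [_ e0 _] := eP.
by rewrite -val_eqE val_corner_one raddf0.
Qed.

HB.instance Definition _ := GRing.Zmodule_isComNzRing.Build eA
  corner_mulA corner_mulC corner_mul1 corner_mulDl corner_one_neq0.

Lemma corner_inv_subproof (x : eA) :
  exists y : eA, if x == 0 then y = 0 else y * x = 1.
Proof.
case: eqP => [_|/eqP x0]; first by exists 0.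
have [_ _ einv] := eP.
have vx0 : val x != 0 by rewrite -val_eqE raddf0 in x0.
have [y xy] := einv _ (corner_val_idem x) vx0.
exists (corner_proj y); apply: val_inj.
by rewrite val_corner_mul val_corner_one val_corner_proj mulrC mulrA xy;
   have [] := eP.
Qed.

Definition corner_inv (x : eA) : eA := sval (cid (corner_inv_subproof x)).

Lemma corner_invP (x : eA) :
  if x == 0 then corner_inv x = 0 else corner_inv x * x = 1.
Proof. exact: svalP (cid (corner_inv_subproof x)). Qed.

Lemma corner_mulVf (x : eA) : x != 0 -> corner_inv x * x = 1.
Proof. by move=> /negPf x0; have := corner_invP x; rewrite x0. Qed.

Lemma corner_inv0 : corner_inv 0 = 0.
Proof. by have := corner_invP 0; rewrite eqxx. Qed.

HB.instance Definition _ := GRing.ComNzRing_isField.Build eA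
  corner_mulVf corner_inv0.

Lemma corner_proj_zmod_morphism : zmod_morphism corner_proj.
Proof.
move=> x y; apply: val_inj; rewrite raddfB /=.
by rewrite mulrBl.
Qed.

Lemma corner_proj_monoid_morphism : monoid_morphism corner_proj.
Proof.
split=> // x y; apply: val_inj; have [ee _ _] := eP.
by rewrite val_corner_mul !val_corner_proj mulrACA ee.
Qed.

HB.instance Definition _ := GRing.isZmodMorphism.Build A eA corner_proj
  corner_proj_zmod_morphism.
HB.instance Definition _ := GRing.isMonoidMorphism.Build A eA corner_proj
  corner_proj_monoid_morphism.

End Corner.

Section Peirce.
Variables (A : comNzRingType) (e e' : A).
Variables (eP : field_idempotent e) (e'P : field_idempotent e').

Definition peirce (x : A) : corner eP * corner e'P :=
  (corner_proj eP x, corner_proj e'P x).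

Lemma peirce_zmod_morphism : zmod_morphism peirce.
Proof. by move=> x y; rewrite /peirce !rmorphB. Qed.

Lemma peirce_monoid_morphism : monoid_morphism peirce.
Proof. by split=> [|x y]; rewrite /peirce ?rmorph1 ?rmorphM. Qed.

HB.instance Definition _ := GRing.isZmodMorphism.Build A
  (corner eP * corner e'P)%type peirce peirce_zmod_morphism.
HB.instance Definition _ := GRing.isMonoidMorphism.Build A
  (corner eP * corner e'P)%type peirce peirce_monoid_morphism.

(** Peirce decomposition: [x = x * e + x * e'], and [e * e' = 0] makes the two
    components independent. *)
Lemma peirce_isomorphic :
  e + e' = 1 -> ring_isomorphic A (corner eP * corner e'P)%type.
Proof.
move=> ee1; have [ee _ _] := eP; have [ee' _ _] := e'P.
have orth : e * e' = 0.
  by apply: (addrI (e * e)); rewrite -mulrDr ee1 mulr1 ee addr0.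
exists peirce; exists (fun p => val p.1 + val p.2) => [x|[y z]].
  by rewrite !val_corner_proj -mulrDr ee1 mulr1.
have ye' : val y * e' = 0 by rewrite -corner_val_idem -mulrA orth mulr0.
have ze : val z * e = 0.
  by rewrite -corner_val_idem -mulrA [e' * e]mulrC orth mulr0.
rewrite /peirce; congr pair; apply: val_inj.
  by rewrite val_corner_proj mulrDl corner_val_idem ze addr0.
by rewrite val_corner_proj mulrDl corner_val_idem ye' add0r.
Qed.

End Peirce.

(** * Structure of quasi second rings *)

Section Structure.
Variable A : comNzRingType.
Hypothesis recover :
  forall a c : A, a * c <> 0 -> invertible a \/ exists d, a = a * c * d.

(** An idempotent other than 1 is not a unit, so it is a multiple of each of its
    nonzero multiples; the elements [x] with [x * e = x] are such multiples. *)
Lemma idempotent_field_idempotent (e : A) :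
  e * e = e -> e <> 0 -> e <> 1 -> field_idempotent e.
Proof.
move=> ee e0 e1; split=> //; first exact/eqP.
move=> x xe /eqP x0.
have ex0 : e * x <> 0 by rewrite mulrC xe.
have [[y ey]|[d E]] := recover ex0.
  by case: e1; rewrite -[e]mulr1 -ey mulrA ee.
by exists d; rewrite [RHS]E [e * x]mulrC xe.
Qed.

(** Recovering [a] from [a * a] as [a * a * d] makes [a * d] an idempotent that
    acts as an identity on [a]; this is what splits the ring. *)
Lemma quasi_second_product (a : A) :
  ~ invertible a -> a * a <> 0 ->
  exists K L : fieldType, ring_isomorphic A (K * L)%type.
Proof.
move=> nua aa0; have [//|[d aE]] := recover aa0.
set e := a * d; have ae : a * e = a by rewrite mulrA -aE.
have ee : e * e = e by rewrite {2}/e mulrA [e * a]mulrC ae.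
have e0 : e <> 0 by move=> E; apply: aa0; rewrite -{1}ae E mulr0 mul0r.
have e1 : e <> 1 by move=> E; apply: nua; exists d.
have eP := idempotent_field_idempotent ee e0 e1.
have e'P : field_idempotent (1 - e).
  apply: idempotent_field_idempotent.
  - by rewrite mulrBl mul1r mulrBr mulr1 ee subrr subr0.
  - by move=> /eqP; rewrite subr_eq0 => /eqP /esym.
  - by move=> /eqP; rewrite -subr_eq0 addrAC subrr add0r oppr_eq0 => /eqP.
exists (corner eP), (corner e'P); apply: peirce_isomorphic.
by rewrite addrC subrK.
Qed.

Definition nonunits : set A := [set a | ~ invertible a].

Lemma proper_ideal_nonunits (J : set A) : is_proper_ideal J -> J `<=` nonunits.
Proof.
move=> [J0 J1 Jcl] x Jx [y xy]; move/negP: J1; apply.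
have := Jcl y x 0; rewrite addr0 mulrC xy; apply=> //.
by rewrite inE.
Qed.

(** Products of non-units vanish, which makes a linear combination of non-units
    have square zero; so the non-units form an ideal. Every proper ideal consists
    of non-units, hence this ideal is the unique maximal one. *)
Lemma quasi_second_local :
  (forall a, nonunits a -> a * a = 0) ->
  local_with_maximal_ideal nonunits /\ ideal_mul nonunits nonunits = [set 0].
Proof.
move=> sq0.
have prod0 a b : nonunits a -> nonunits b -> a * b = 0.
  move=> na nb; have [//|ab0] := pselect (a * b = 0).
  have [//|[d E]] := recover ab0.
  by rewrite E mulrAC -[a * b * b]mulrA (sq0 b) // mulr0 mul0r.
have n0 : nonunits 0.
  by move=> [x]; rewrite mul0r => /esym /eqP; rewrite oner_eq0.
have nil (x : A) : x * x = 0 -> nonunits x.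
  move=> xx [y xy]; have : x = 0 by rewrite -[x]mulr1 -xy mulrA xx mul0r.
  by move=> x0; apply: n0; exists y; rewrite -x0.
have proper : is_proper_ideal nonunits.
  split; first by rewrite inE.
    by rewrite inE; apply/negP => /asboolP; apply; exists 1; rewrite mulr1.
  move=> r x y; rewrite !inE => nx ny; apply: nil.
  have -> : (r * x + y) * (r * x + y)
          = r * r * (x * x) + r * (x * y) *+ 2 + y * y by ring.
  by rewrite (prod0 x x) // (prod0 x y) // (prod0 y y) // !mulr0 mul0rn !addr0.
split; last first.
  apply/seteqP; split=> [_ [n [u [v [nu nv ->]]]]|_ ->] /=.
    by apply: big1 => i _; apply: prod0.
  by exists 0%N, (fun=> 0), (fun=> 0); split=> //; rewrite big_ord0.
split=> [|J [Jproper Jmax]].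
  split=> // J /proper_ideal_nonunits Jn nJ.
  by apply/seteqP; split.
by apply: Jmax => //; apply: proper_ideal_nonunits.
Qed.

End Structure.

Theorem theorem11 (A : comNzRingType) :
  quasi_second_ring A <->
  ((exists2 m : set A,
      local_with_maximal_ideal m & ideal_mul m m = [set 0]) \/
   (exists K L : fieldType, ring_isomorphic A (K * L)%type)).
Proof.
split=> [/quasi_second_ringP recover|[[m [mmax _] mm0]|[K [L iso]]]].
- have [[a na aa0]|sq0] := pselect (exists2 a : A, nonunits a & a * a <> 0).
    by right; apply: quasi_second_product recover a na aa0.
  left; have [|nlocal nn0] := quasi_second_local recover.
    by move=> a na; have [//|aa0] := pselect (a * a = 0); case: sq0; exists a.
  by exists (@nonunits A).
- exact: local_quasi_second mmax mm0.
- exact: field_product_quasi_second iso.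
Qed.
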